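(* Let $K,L\subseteq\mathbb{R}^n$ be convex bodies with $0\in K\cap L$. For every $\theta\in[0,1]$, \[ \mathrm{Vol}(L\vee(-K))\,\mathrm{Vol}\big(\theta K\cap(1-\theta)L\big)\le \mathrm{Vol}(K)\,\mathrm{Vol}(L). \]
   Context: A convex body is a compact convex subset of $\mathbb{R}^n$ with non-empty interior. For sets $A,B$, $A\vee B$ denotes the convex hull of $A\cup B$. *)

(* Defs.v *)
From HB Require Import structures.
From mathcomp Require Import all_boot all_order all_algebra.
From mathcomp Require Import all_classical all_reals all_analysis.
Set Implicit Arguments. Unset Strict Implicit. Unset Printing Implicit Defensive.
Import Order.TTheory GRing.Theory Num.Theory.
Import numFieldNormedType.Exports.
Local Open Scope classical_set_scope.
Local Open Scope ring_scope.

Definition convex_set (R : realType) (n : nat) (A : set 'rV[R]_n) : Prop :=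
  forall x y t, A x -> A y -> 0 <= t <= 1 -> A (t *: x + (1 - t) *: y).

Definition convex_body (R : realType) (n : nat) (A : set 'rV[R]_n) : Prop :=
  compact A /\ convex_set A /\ (interior A !=set0).

Definition cvx_join (R : realType) (n : nat) (A B : set 'rV[R]_n) : set 'rV[R]_n :=
  [set x | forall C : set 'rV[R]_n, convex_set C -> A `|` B `<=` C -> C x].

Definition dil (R : realType) (n : nat) (t : R) (A : set 'rV[R]_n) : set 'rV[R]_n :=
  [set t *: x | x in A].
Definition refl (R : realType) (n : nat) (A : set 'rV[R]_n) : set 'rV[R]_n :=
  [set - x | x in A].

Definition box (R : realType) (n : nat) (a b : 'rV[R]_n) : set 'rV[R]_n :=
  [set x | forall i : 'I_n, a ord0 i <= x ord0 i <= b ord0 i].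
Definition box_vol (R : realType) (n : nat) (a b : 'rV[R]_n) : R :=
  \prod_(i < n) Num.max 0 (b ord0 i - a ord0 i).

Definition Vol (R : realType) (n : nat) (A : set 'rV[R]_n) : \bar R :=
  ereal_inf [set s : \bar R | exists (a b : nat -> 'rV[R]_n),
    A `<=` \bigcup_k box (a k) (b k) /\
    s = (\sum_(0 <= k <oo) (box_vol (a k) (b k))%:E)%E].

(* Main.v *)
(* Count points of the lattice h Z^n and let h tend to 0. For t in [0, 1] the volume
   of t K times that of (1 - t) L is the integral over x of the volume of
   t K `&` ((1 - t) L - x). Write M for theta K `&` (1 - theta) L and P for the
   join of L and - K, and let s be the gauge of x with respect to P. For every
   r >= s, the fibre over x contains a translate of (1 - r) M for all t in an
   interval of length r - s. Integrating over t and x, without using the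
   Brunn-Minkowski inequality, gives
     Vol K Vol L B(n + 1, n + 1) >= Vol P Vol M B(n + 1, n + 1).
   With t and the gauges restricted to multiples of 1 / m, the two beta integrals
   become S_m and S_(m - 1), where S_m is the sum of j^n (m - j)^n; since S_m
   grows polynomially in m, the inequality for all m still gives the claim. *)
Require Import Defs.
From HB Require Import structures.
From mathcomp Require Import all_boot all_order all_algebra.
From mathcomp Require Import all_classical all_reals all_analysis.
From mathcomp Require Import ring lra zify.
Set Implicit Arguments. Unset Strict Implicit. Unset Printing Implicit Defensive.
Import Order.TTheory GRing.Theory Num.Theory.
Import numFieldNormedType.Exports.
Local Open Scope classical_set_scope.
Local Open Scope ring_scope.

(** * Sums over countable types and counting *)

Lemma le_esumZl (R : realType) (T : choiceType) (A : set T) (c : R)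
    (f : T -> \bar R) : 0 <= c -> (forall x, 0 <= f x)%E ->
  (\esum_(x in A) (c%:E * f x) <= c%:E * \esum_(x in A) f x)%E.
Proof.
move=> c0 f0; apply: ge_ereal_sup => _ [F [finF FA] <-].
rewrite -ge0_mule_fsumr//.
apply: lee_wpmul2l; first by rewrite lee_fin.
by apply: ereal_sup_ubound; exists F.
Qed.

(** For [c] nonzero, the missing inequality is [le_esumZl] applied to [c^-1] and to [c f]. *)
Lemma esumZl (R : realType) (T : choiceType) (A : set T) (c : R)
    (f : T -> \bar R) : 0 <= c -> (forall x, 0 <= f x)%E ->
  (\esum_(x in A) (c%:E * f x) = c%:E * \esum_(x in A) f x)%E.
Proof.
move=> c0 f0; have cf0 x : (0 <= c%:E * f x)%E by rewrite mule_ge0.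
apply/eqP; rewrite eq_le le_esumZl//=.
have [->|cN0] := eqVneq c 0; first by rewrite mul0e esum_ge0// => x _; rewrite mul0e.
have le_f : (\esum_(x in A) f x <= (c^-1)%R%:E * \esum_(x in A) (c%:E * f x))%E.
  apply: le_trans (le_esumZl _ _ _); rewrite ?invr_ge0//.
  by apply: le_esum => x _; rewrite muleA -EFinM mulVf// mul1e.
apply: le_trans (lee_wpmul2l _ le_f) _; first by rewrite lee_fin.
by rewrite muleA -EFinM divff// mul1e.
Qed.

Lemma esum_exchange (R : realType) (T1 T2 : choiceType) (a : T1 -> T2 -> \bar R) :
  (forall x y, 0 <= a x y)%E ->
  (\esum_(x in setT) \esum_(y in setT) a x y =
   \esum_(y in setT) \esum_(x in setT) a x y)%E.
Proof.
move=> a0; rewrite !esum_esum//.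
rewrite (reindex_esum (setT `*`` (fun=> setT)) _ (fun p => (p.2, p.1)))//.
split; first by move=> [].
- by move=> [? ?] [? ?] _ _ [-> ->].
- by move=> [x y] _; exists (y, x).
Qed.

(** Counting measure as an extended real sum, so that infinite sets count [+oo] and sums over
    lattice points can be exchanged. *)
Definition card_set (R : realType) (T : choiceType) (A : set T) : \bar R :=
  \esum_(x in A) 1%E.
Arguments card_set R {T} A.

Lemma card_set_ge0 (R : realType) (T : choiceType) (A : set T) :
  (0 <= card_set R A)%E.
Proof. exact: esum_ge0. Qed.

Lemma card_set_mkcond (R : realType) (T : choiceType) (A : set T) :
  (card_set R A = \esum_(x in setT) (x \in A)%:R%:E)%E.
Proof. by rewrite /card_set esum_mkcond; apply: eq_esum => x _; case: ifP. Qed.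

Lemma le_card_set (R : realType) (T : choiceType) (A B : set T) :
  A `<=` B -> (card_set R A <= card_set R B)%E.
Proof.
move=> AB; rewrite !card_set_mkcond; apply: le_esum => x _.
rewrite lee_fin ler_nat; case: (boolP (x \in A)) => // /set_mem /AB.
by move/mem_set ->.
Qed.

Lemma card_set_image_le (R : realType) (F : finType) (T : choiceType)
    (e : F -> T) (A : set F) (B : set T) :
  injective e -> B `<=` e @` A ->
  (card_set R B <= (\sum_(f : F) (f \in A)%:R)%:E)%E.
Proof.
move=> einj BA; apply: le_trans (le_card_set _ BA) _.
rewrite /card_set (esum_image A)//; last by move=> x y _ _; exact: einj.
rewrite esum_mkcond esum_fset; first last.
- by move=> i _; case: ifP.
- exact: finite_finset.
rewrite (fsbigE (index_enum F))//=; first 1 last.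
- exact: index_enum_uniq.
- by move=> i _; rewrite mem_index_enum.
by rewrite -sumEFin big_mkcond/=; apply: lee_sum => f _; rewrite in_setT; case: ifP.
Qed.

Lemma card_set_bigcup_le (R : realType) (T : choiceType) (I : choiceType)
    (s : seq I) (S : I -> set T) (A : set T) :
  (forall x, A x -> exists2 i, i \in s & S i x) ->
  (card_set R A <= \sum_(i <- s) card_set R (S i))%E.
Proof.
move=> AS; under eq_bigr do rewrite card_set_mkcond.
rewrite card_set_mkcond -esum_sum; last by move=> *; rewrite lee_fin.
apply: le_esum => x _; case: (boolP (x \in A)) => [/set_mem/AS[i si Six]|_].
  rewrite (big_rem i)//= mem_set//; apply: leeDl.
  by apply: sume_ge0 => j _; rewrite lee_fin.
by apply: sume_ge0 => j _; rewrite lee_fin.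
Qed.

Lemma card_set_shift (R : realType) (T : countZmodType) (A : set T) (v : T) :
  card_set R [set x | A (v + x)] = card_set R A.
Proof.
rewrite /card_set (reindex_esum [set x | A (v + x)] A (fun x => v + x))//.
split => //=.
- by move=> x y _ _; exact: addrI.
- by move=> x Ax; exists (x - v); rewrite /= addrC subrK.
Qed.

(* Substitute (x, w) |-> (w, w + x). *)
Lemma card_set_conv (R : realType) (T : countZmodType) (A B : set T) (b : R) :
  (card_set R B = b%:E)%E ->
  (\esum_(x in setT) card_set R [set w | A w /\ B (w + x)%R] = card_set R A * b%:E)%E.
Proof.
move=> Bb; under eq_esum do rewrite card_set_mkcond.
have b0 : 0 <= b by rewrite -lee_fin -Bb card_set_ge0.
rewrite esum_exchange; last by move=> *; rewrite lee_fin.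
rewrite card_set_mkcond muleC -esumZl//.
apply: eq_esum => w _.
have -> : (\esum_(i in setT) ((w \in [set w | A w /\ B (w + i)%R])%:R : R)%:E =
  ((w \in A)%:R : R)%:E * \esum_(i in setT) (i \in [set i | B (w + i)%R])%:R%:E)%E.
  rewrite -esumZl//; apply: eq_esum => i _.
  rewrite -EFinM -natrM mulnb; congr ((nat_of_bool _)%:R%:E).
  by apply/idP/andP; rewrite !inE.
by rewrite -card_set_mkcond card_set_shift Bb muleC.
Qed.

(** * Lattice counts compared with volumes *)

(** The tolerance [rho] absorbs rounding: [h] suffices to bound a volume by a count, and [2 * h] is
    used where two points, each known up to [h], are added. *)
Definition lattice_near (R : realType) (n : nat) (h rho : R) (A : set 'rV[R]_n) :
    set 'rV[int]_n :=
  [set z | exists2 a, A a &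
    forall i, `|h * (z ord0 i)%:~R - a ord0 i| <= rho].

Lemma box_vol_ge0 (R : realType) (n : nat) (a b : 'rV[R]_n) : 0 <= box_vol a b.
Proof. by apply: prodr_ge0 => i _; rewrite le_max lexx. Qed.

Lemma box_vol_cst (R : realType) (n : nat) (a b : 'rV[R]_n) (s : R) :
  0 <= s -> (forall i, b ord0 i - a ord0 i = s) -> box_vol a b = s ^+ n.
Proof.
move=> s0 abs; rewrite /box_vol (eq_bigr (fun=> s)) => [|i _].
  by rewrite prodr_const card_ord.
by rewrite abs; apply/max_idPr.
Qed.

Lemma box_vol_eq0 (R : realType) (n : nat) (a b : 'rV[R]_n) :
  (0 < n)%N -> (forall i, b ord0 i <= a ord0 i) -> box_vol a b = 0.
Proof.
case: n a b => // n a b _ ba; rewrite /box_vol big_ord_recl.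
by rewrite (_ : Num.max _ _ = 0) ?mul0r//; apply/max_idPl; rewrite subr_le0.
Qed.

(** Rounding [v + c x] down to the lattice places it in a cube of side [h] at a near lattice point.
    The preimages of these cubes, of side [h / c], cover [A] and so compete in the infimum
    [Vol A]. *)
Lemma Vol_lattice_le (R : realType) (n : nat) (A : set 'rV[R]_n) (v : 'rV[R]_n)
    (c h : R) : (0 < n)%N -> 0 <= c -> 0 < h ->
  ((c ^+ n)%:E * Vol A <=
   (h ^+ n)%:E * card_set R (lattice_near h h [set (v + c *: a)%R | a in A]))%E.
Proof.
move=> n0; rewrite le_eqVlt => /predU1P[<-|c0] h0.
  rewrite expr0n gtn_eqF// mul0e mule_ge0// ?card_set_ge0//.
  by rewrite lee_fin exprn_ge0// ltW.
set S := lattice_near _ _ _.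
pose lo (z : 'rV[int]_n) : 'rV[R]_n := \row_i (c^-1 * (h * (z ord0 i)%:~R - v ord0 i)).
pose hi (z : 'rV[int]_n) : 'rV[R]_n := \row_i (c^-1 * (h * (z ord0 i)%:~R - v ord0 i) + h / c).
(* The boxes are numbered by [pickle]. An index that codes no point of [S] gets the box from 1 to 0,
   which is empty and has volume 0. *)
pose sel (f : 'rV[int]_n -> 'rV[R]_n) (d : 'rV[R]_n) k :=
  if pickle_inv k is Some z then if z \in S then f z else d else d.
pose a := sel lo (const_mx 1); pose b := sel hi (const_mx 0).
have hc0 : 0 <= h / c by rewrite divr_ge0 ?ltW.
have volE k : ((box_vol (a k) (b k))%:E =
    if k \in [set pickle z | z in S] then ((h / c) ^+ n)%:E else 0)%E.
  rewrite /a /b /sel; case: ifPn => [/set_mem[z Sz <-]|nS].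
    rewrite pickleK_inv mem_set//; congr EFin; apply: box_vol_cst => // i.
    by rewrite !mxE addrC addKr.
  have vol0 : box_vol (const_mx 1 : 'rV[R]_n) (const_mx 0) = 0.
    by apply: box_vol_eq0 => // i; rewrite !mxE.
  have := @pickle_invK 'rV[int]_n k.
  case: pickle_inv => [z /= zk|]; last by rewrite vol0.
  case: ifPn => [/set_mem Sz|]; last by rewrite vol0.
  by exfalso; move/negP: nS; apply; rewrite inE; exists z.
have le_vol : (Vol A <= ((h / c) ^+ n)%:E * card_set R S)%E.
  apply: ereal_inf_lbound; exists a, b; split; last first.
    rewrite nneseries_esumT => [|k]; last by rewrite lee_fin box_vol_ge0.
    under eq_esum do rewrite volE.
    rewrite -esum_mkcond esum_image; last first.
      by move=> x y _ _; exact: (pcan_inj pickleK).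
    rewrite -esumZl//; last by rewrite exprn_ge0.
    by apply: eq_esum => z _; rewrite mule1.
  move=> x Ax; pose z : 'rV[int]_n :=
    \row_i Num.floor ((v ord0 i + c * x ord0 i) / h).
  have zP i : h * (z ord0 i)%:~R <= v ord0 i + c * x ord0 i <=
      h * (z ord0 i)%:~R + h.
    rewrite mxE; set y := v ord0 i + _.
    have := floor_le (y / h); rewrite ler_pdivlMr// mulrC => ->/=.
    have := lt_succ_floor (y / h).
    by rewrite ltr_pdivrMr// intrD1 mulrDl mul1r mulrC => /ltW.
  have Sz : S z.
    exists (v + c *: x); first by exists x.
    by move=> i; move: (zP i); rewrite !mxE => /andP[z1 z2]; rewrite ler_norml; lra.
  exists (pickle z) => // i; rewrite /a /b /sel pickleK_inv mem_set//.
  move: (zP i); rewrite !mxE => /andP[]; set zi := h * _ => z1 z2.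
  by rewrite !(mulrC c^-1) -mulrDl ler_pdivrMr// ler_pdivlMr//; lra.
apply: le_trans (lee_wpmul2l _ le_vol) _; first by rewrite lee_fin exprn_ge0 ?ltW.
by rewrite muleA -EFinM -exprMn mulrC divfK// gt_eqF.
Qed.

Lemma sum_le_div (R : realType) (h l : R) (M : nat) : 0 < h -> 0 <= l ->
  \sum_(j < M) ((h * j%:R <= l)%R%:R : R) <= l / h + 1.
Proof.
move=> h0 l0; elim: M => [|M IH].
  by rewrite big_ord0 addr_ge0// divr_ge0// ltW.
rewrite big_ord_recr/=; case: (boolP (h * M%:R <= l)) => [Ml|_]; last by rewrite addr0.
apply: (@le_trans _ _ (M%:R + 1)); last by rewrite lerD2r ler_pdivlMr// mulrC.
rewrite lerD2r -[M in leRHS]card_ord -sumr_const.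
by apply: ler_sum => j _; rewrite lern1 leq_b1.
Qed.

(** In each coordinate a lattice point of the box is the ceiling [c i] plus an offset [j] with
    [h j <= l i]. There are at most [l i / h + 1] offsets, and the count over all coordinates is at
    most the product of these. *)
Lemma lattice_box_le (R : realType) (n : nat) (a b : 'rV[R]_n) (h : R) : 0 < h ->
  ((h ^+ n)%:E * card_set R [set z : 'rV[int]_n |
      forall i, (a ord0 i <= h * (z ord0 i)%:~R <= b ord0 i)%R] <=
   (\prod_(i < n) (Num.max 0 (b ord0 i - a ord0 i) + h))%R%:E)%E.
Proof.
move=> h0; set S := [set z | _].
pose l i : R := Num.max 0 (b ord0 i - a ord0 i).
have l0 i : 0 <= l i by rewrite le_max lexx.
pose c i := Num.ceil (a ord0 i / h).
have hc i : a ord0 i <= h * (c i)%:~R.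
  by rewrite mulrC -ler_pdivrMr// ceil_ge.
pose M := \max_(i < n) Num.truncn (l i / h).
pose e (f : {ffun 'I_n -> 'I_M.+1}) : 'rV[int]_n := \row_i (c i + (f i : nat)%:Z).
pose F := [set f : {ffun 'I_n -> 'I_M.+1} | forall i, h * (f i : nat)%:R <= l i].
have einj : injective e.
  move=> f g /rowP fg; apply/ffunP => i; apply/val_inj.
  by have := fg i; rewrite !mxE => /addrI [].
have SF : S `<=` e @` F.
  move=> z Sz.
  have zc i : (0 <= z ord0 i - c i)%R.
    rewrite subr_ge0 ceil_le_int ler_pdivrMr// mulrC.
    by have /andP[] := Sz i.
  have zl i : h * (absz (z ord0 i - c i))%:R <= l i.
    rewrite natr_absz ger0_norm// intrB mulrBr le_max; apply/orP; right.
    by move: (hc i) (Sz i) => ? /andP[? ?]; lra.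
  have zM i : (absz (z ord0 i - c i) < M.+1)%N.
    rewrite ltnS; apply: leq_trans (leq_bigmax i).
    rewrite truncn_ge_nat; last by rewrite divr_ge0// ltW.
    by rewrite ler_pdivlMr// mulrC.
  exists [ffun i => Ordinal (zM i)]; first by move=> i; rewrite ffunE/=; exact: zl.
  apply/rowP => i; rewrite mxE ffunE/= gez0_abs//.
  by rewrite subrKC.
apply: le_trans (lee_wpmul2l _ (card_set_image_le R einj SF)) _.
  by rewrite lee_fin exprn_ge0// ltW.
rewrite -EFinM lee_fin.
(* The indicator of [F] is a product over coordinates, so the sum over finite functions factors. *)
have -> : \sum_f (f \in F)%:R =
    \sum_(f : {ffun 'I_n -> 'I_M.+1}) \prod_i ((h * (f i : nat)%:R <= l i)%R%:R : R).
  apply: eq_bigr => f _; case: (boolP (f \in F)) => [/set_mem Ff|nF].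
    by rewrite big1// => i _; rewrite Ff.
  have [i /negbTE fi] : exists i, ~~ (h * (f i : nat)%:R <= l i).
    by apply/existsP; rewrite -negb_forall; apply: contra nF => /forallP Ff; rewrite inE.
  by rewrite (bigD1 i)//= fi mul0r.
rewrite -(bigA_distr_bigA (fun i (j : 'I_M.+1) => ((h * (j : nat)%:R <= l i)%R%:R : R))).
rewrite -[X in h ^+ X]card_ord -prodr_const -big_split/=.
apply: ler_prod => i _; apply/andP; split.
  by rewrite mulr_ge0 ?(ltW h0)// sumr_ge0// => j _; rewrite ler0n.
apply: le_trans (ler_wpM2l (ltW h0) (sum_le_div _ h0 (l0 i))) _.
by rewrite mulrDr mulr1 mulrC divfK// gt_eqF.
Qed.

(** An error linear in [c], with a constant depending only on [X] and [n], is what allows box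
    enlargements to be made negligible. *)
Lemma prod_add_le (R : realType) (n : nat) (x : 'I_n -> R) (c X : R) :
  0 <= c <= 1 -> (forall i, 0 <= x i <= X) ->
  \prod_(i < n) (x i + c) <= \prod_(i < n) x i + c * (X + 2) ^+ n.
Proof.
move=> /andP[c0 c1].
elim: n x => [|n IH] x xX; first by rewrite !big_ord0 mulr1 lerDl.
have /andP[x0 xX0] := xX ord0.
have X0 : 0 <= X by exact: le_trans x0 xX0.
have px : 0 <= \prod_(i < n) x (lift ord0 i) <= X ^+ n.
  apply/andP; split; first by apply: prodr_ge0 => i _; case/andP: (xX (lift ord0 i)).
  by rewrite -[X in _ <= _ ^+ X]card_ord -prodr_const; apply: ler_prod.
have XX : X ^+ n <= (X + 2) ^+ n by apply: lerXn2r; rewrite ?nnegrE; lra.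
rewrite !big_ord_recl/= exprS; move: px XX (IH _ (fun i => xX (lift ord0 i))).
set p := \prod_(i < n) x _; set q := \prod_(i < n) (_ + c).
set Y := X ^+ n; set Z := (X + 2) ^+ n => /andP[p0 pY] YZ qp.
have : (x ord0 + c) * q <= (x ord0 + c) * (p + c * Z).
  by apply: ler_wpM2l => //; lra.
have Z0 : 0 <= Z by lra.
have u0 : 0 <= (X - x ord0) * Z by rewrite mulr_ge0// subr_ge0.
have v0 : 0 <= (1 - c) * Z by rewrite mulr_ge0// subr_ge0.
(* This is the slack of the induction step, [x p + c (X + 2) Z - (x + c) (p + c Z)] with [x] the
   first entry. *)
have : 0 <= c * ((X - x ord0) * Z + (Z - p) + (1 - c) * Z).
  by rewrite mulr_ge0//; lra.
by nra.
Qed.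

Lemma open_obox (R : realType) (n : nat) (a b : 'rV[R]_n) :
  open [set x : 'rV[R]_n | forall i, a ord0 i < x ord0 i < b ord0 i].
Proof.
rewrite openE => x /= xab.
exists (fun _ i => [set y | a ord0 i < y < b ord0 i]) => [j i|y yab i].
  rewrite (ord1 j); have /andP[ax xb] := xab i.
  have : (x ord0 i) \in `]a ord0 i, b ord0 i[ by rewrite in_itv/= ax.
  by move/near_in_itvoo; apply: filterS => y; rewrite /= in_itv.
exact: yab.
Qed.

Lemma seq_min_gt0 (R : realType) (I : eqType) (s : seq I) (e : I -> R) :
  (forall i, 0 < e i) -> exists2 m, 0 < m & forall i, i \in s -> m <= e i.
Proof.
move=> e0; elim: s => [|i s [m m0 ms]]; first by exists 1.
exists (Num.min (e i) m) => [|j]; first by rewrite lt_min e0.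
by rewrite in_cons ge_min => /predU1P[->|/ms ->]; rewrite ?lexx ?orbT.
Qed.

Lemma compact_obox_cover (R : realType) (n : nat) (K : set 'rV[R]_n)
    (a b : nat -> 'rV[R]_n) : compact K ->
  K `<=` \bigcup_k [set x : 'rV[R]_n |
    forall i, (a k) ord0 i < x ord0 i < (b k) ord0 i] ->
  exists2 s : seq nat, uniq s & forall x, K x -> exists2 k, k \in s &
    forall i, (a k) ord0 i < x ord0 i < (b k) ord0 i.
Proof.
rewrite compact_cover => cK Kab.
have [|D _ KD] := cK _ _ _ _ Kab; first by move=> k _; exact: open_obox.
exists (finmap.enum_fset D); first exact: finmap.fset_uniq.
by move=> x /KD[k kD xk]; exists k.
Qed.

Lemma Vol_ge0 (R : realType) (n : nat) (A : set 'rV[R]_n) : (0 <= Vol A)%E.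
Proof.
apply: le_ereal_inf_tmp => _ [a [b [_ ->]]].
by apply: nneseries_ge0 => k _ _; rewrite lee_fin box_vol_ge0.
Qed.

(** Compactness puts [K] in a cube with half-side [M]; this cube at index 0 and empty boxes
    elsewhere form a cover of finite total volume. *)
Lemma compact_Vol_fin_num (R : realType) (n : nat) (K : set 'rV[R]_n) :
  (0 < n)%N -> compact K -> Vol K \is a fin_num.
Proof.
move=> n0 cK.
have [|s _ Ks] := @compact_obox_cover R n K (fun k => const_mx (- k%:R))
    (fun k => const_mx k%:R) cK.
  move=> x Kx; exists (\max_(i < n) Num.truncn `|x ord0 i|).+1 => // i.
  rewrite !mxE -ltr_norml -truncn_lt_nat//.
  by rewrite ltnS (leq_bigmax (F := fun i : 'I_n => Num.truncn `|x ord0 i|)).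
pose M := \max_(k <- s) k.
pose a k : 'rV[R]_n := if k == 0%N then const_mx (- M%:R) else const_mx 1.
pose b k : 'rV[R]_n := if k == 0%N then const_mx M%:R else const_mx 0.
have VK : (Vol K <= (box_vol (a 0%N) (b 0%N))%:E)%E.
  apply: ereal_inf_lbound; exists a, b; split.
    move=> x /Ks[k ks xk]; exists 0%N => // i; rewrite !mxE.
    have := xk i; rewrite !mxE => /andP[/ltW kx /ltW xk'].
    have kM : (k%:R <= M%:R :> R) by rewrite ler_nat; exact: leq_bigmax_seq.
    by apply/andP; split; lra.
  rewrite (nneseries_split 0 1)//; last by move=> k _; rewrite lee_fin box_vol_ge0.
  rewrite add0n big_nat1 eseries0 ?adde0// => -[|k]// _ _.
  by rewrite /a /b/= box_vol_eq0// => i; rewrite !mxE.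
by rewrite ge0_fin_numE ?Vol_ge0// (le_lt_trans VK)// ltry.
Qed.

(** Take a countable cover of [K] of total volume below [kap + eta / 2], enlarge its boxes slightly
    to open ones and extract a finite subcover. For small [h], counting in the boxes scaled by [t]
    costs at most [d k] for box [k], and the [d k] sum to [eta / 2]. One subcover serves all [t], so
    [h0] does not depend on [t]. *)
Lemma lattice_compact_le (R : realType) (n : nat) (K : set 'rV[R]_n) (kap eta : R) :
  compact K -> Vol K = kap%:E -> 0 < eta ->
  exists2 h0 : R, 0 < h0 & forall h t, 0 < h <= h0 -> 0 <= t <= 1 ->
    ((h ^+ n)%:E * card_set R (lattice_near h (2 * h) (dil t K)) <=
     (t ^+ n * kap + eta)%:E)%E.
Proof.
move=> cK VK eta0.
have [_ [a [b [Kab ->]]] volab] : exists2 s, [set s : \bar R |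
    exists (a b : nat -> 'rV[R]_n), K `<=` \bigcup_k box (a k) (b k) /\
    s = (\sum_(0 <= k <oo) (box_vol (a k) (b k))%:E)%E] s &
    (s < (kap + eta / 2)%:E)%E.
  have : (Vol K < (kap + eta / 2)%:E)%E by rewrite VK lte_fin; lra.
  by move/ereal_inf_lt => [s sV sk]; exists s.
pose l k i : R := Num.max 0 (b k ord0 i - a k ord0 i).
have l0 k i : 0 <= l k i by rewrite le_max lexx.
pose X k : R := \sum_i l k i.
have lX k i : l k i <= X k.
  by rewrite /X (bigD1 i)//= lerDl sumr_ge0.
have X0 k : 0 <= X k by apply: sumr_ge0.
pose d k : R := (eta / 2) / (2 ^ k.+1)%:R.
have d0 k : 0 < d k by rewrite !divr_gt0// ltr0n expn_gt0.
pose C k : R := (X k + 2) ^+ n.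
have C0 k : 0 < C k by apply: exprn_gt0; have := X0 k; lra.
(* A side grows by at most [7 * e k]: [2 * e k] from opening the box, [4 * h] from the tolerance at
   both ends and [h] from counting, with [h <= e k]. *)
pose e k : R := Num.min (1 / 7) (d k / (7 * C k)).
have e0 k : 0 < e k.
  by rewrite lt_min !divr_gt0// mulr_gt0.
have e1 k : 7 * e k <= 1.
  have : e k <= 1 / 7 by rewrite ge_min lexx.
  by lra.
have eC k : 7 * e k * C k <= d k.
  have : e k <= d k / (7 * C k) by rewrite ge_min lexx orbT.
  by rewrite ler_pdivlMr ?mulr_gt0//; lra.
have [x Kx|s us Ks] := @compact_obox_cover R n K
    (fun k => a k - const_mx (e k)) (fun k => b k + const_mx (e k)) cK.
  have [k _ xk] := Kab x Kx; exists k => // i; rewrite !mxE.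
  by have /andP[? ?] := xk i; have := e0 k; lra.
have [h0 h00 h0s] := seq_min_gt0 s e0.
exists h0 => // h t /andP[hgt0 hh0] /andP[t0 t1].
pose S k := [set z : 'rV[int]_n | forall i,
  (t *: (a k - const_mx (e k)) - const_mx (2 * h)) ord0 i <=
  h * (z ord0 i)%:~R <=
  (t *: (b k + const_mx (e k)) + const_mx (2 * h)) ord0 i].
have cardS k : k \in s -> ((h ^+ n)%:E * card_set R (S k) <=
    (t ^+ n)%:E * (box_vol (a k) (b k))%:E + (d k)%:E)%E.
  move=> ks; apply: le_trans (lattice_box_le _ _ hgt0) _.
  have he : h <= e k by apply: le_trans hh0 (h0s k ks).
  have te : t * e k <= e k by rewrite ler_piMl// ltW.
  rewrite -EFinM -EFinD lee_fin.
  apply: (@le_trans _ _ (\prod_(i < n) (t * l k i + 7 * e k))).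
    apply: ler_prod => i _; rewrite !mxE; apply/andP; split.
      by rewrite addr_ge0// ?le_max ?lexx// ltW.
    have tl : t * (b k ord0 i - a k ord0 i) <= t * l k i.
      by apply: ler_wpM2l => //; rewrite le_max lexx orbT.
    have tl0 : 0 <= t * l k i by rewrite mulr_ge0.
    rewrite -lerBrDr ge_max; apply/andP; split; first by lra.
    by rewrite !mulrDr !mulrN in tl *; lra.
  apply: le_trans (prod_add_le (X := X k) _ _) _.
  - by rewrite e1 andbT mulr_ge0// ltW.
  - by move=> i; rewrite mulr_ge0//=; apply: le_trans (lX k i); rewrite ler_piMl.
  by rewrite big_split/= prodr_const card_ord lerD.
apply: (@le_trans _ _ (\sum_(k <- s) ((h ^+ n)%:E * card_set R (S k)))%E).
  rewrite -ge0_sume_distrr; last by move=> k _; exact: card_set_ge0.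
  apply: lee_wpmul2l; first by rewrite lee_fin exprn_ge0// ltW.
  apply: card_set_bigcup_le => z [_ [x Kx <-] zx].
  have [k ks xk] := Ks x Kx; exists k => // i.
  have := zx i; have := xk i; rewrite !mxE ler_norml => /andP[ax xb] /andP[z1 z2].
  have tax := ler_wpM2l t0 (ltW ax); have txb := ler_wpM2l t0 (ltW xb).
  by apply/andP; split; lra.
apply: (@le_trans _ _ (\sum_(k <- s)
    ((t ^+ n)%:E * (box_vol (a k) (b k))%:E + (d k)%:E))%E).
  by rewrite !big_seq; apply: lee_sum => k; exact: cardS.
have f0 k : (0 <= (t ^+ n)%:E * (box_vol (a k) (b k))%:E)%E.
  by rewrite mule_ge0// lee_fin ?exprn_ge0// box_vol_ge0.
apply: (@le_trans _ _ (\sum_(0 <= k <oo)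
    ((t ^+ n)%:E * (box_vol (a k) (b k))%:E + (d k)%:E))%E).
  rewrite nneseries_esumT => [|k]; last by rewrite adde_ge0// lee_fin ltW.
  apply: esum_ge; exists [set` s]; first by split => //; exact: finite_seq.
  by rewrite fsbig_seq.
apply: le_trans (epsilon_trick _ _ _) _ => //; first by lra.
rewrite nneseriesZl => [|k _]; last by rewrite lee_fin box_vol_ge0.
apply: (@le_trans _ _ ((t ^+ n)%:E * (kap + eta / 2)%:E + (eta / 2)%:E)%E).
  apply: leeD2r; apply: lee_wpmul2l; first by rewrite lee_fin exprn_ge0.
  exact: ltW.
rewrite -EFinM -EFinD lee_fin mulrDr -addrA lerD2l.
have tn1 : t ^+ n <= 1 by rewrite exprn_ile1.
have : t ^+ n * (eta / 2) <= eta / 2 by apply: ler_piMl => //; lra.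
by lra.
Qed.

(** * Discrete windows and nested levels *)

(* The windows [a_k, a_k + (k - i)], a_k = (m - k) theta + i lam, are nested; as
   k increases by one, the k - i consecutive integers starting at the ceiling of
   a_k gain exactly one element, at one of the two ends. *)
Lemma nested_window_sum (R : realType) (theta lam : R) (i m : nat)
    (g H : nat -> \bar R) :
  0 <= theta <= 1 -> 0 <= lam <= 1 -> (i <= m)%N -> (forall j, 0 <= H j)%E ->
  (forall k j : nat, (i < k <= m)%N ->
    (m%:R - k%:R) * theta + i%:R * lam <= j%:R <=
      (m%:R - k%:R) * theta + i%:R * lam + (k%:R - i%:R) -> (g k <= H j)%E) ->
  (\sum_(i.+1 <= k < m.+1) g k <= \sum_(0 <= j < m.+1) H j)%E.
Proof.
move=> /andP[th0 th1] /andP[la0 la1] im H0 gH.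
pose a d : R := (m%:R - (i + d)%:R) * theta + i%:R * lam.
have win d : (i + d <= m)%N -> exists f : nat, [/\ a d <= f%:R, f%:R < a d + 1 &
    (\sum_(i.+1 <= k < (i + d).+1) g k <= \sum_(f <= j < f + d) H j)%E].
  elim: d => [|d IH] dm.
    have a0 : 0 <= a 0%N.
      by rewrite addr_ge0// mulr_ge0// ?ler0n// subr_ge0 ler_nat.
    have [f fa] : exists f : nat, Num.ceil (a 0%N) = f%:Z.
      by exists (absz (Num.ceil (a 0%N))); rewrite gez0_abs// ceil_ge0; lra.
    exists f; have := ceil_itv (a 0%N); rewrite fa intrB => /andP[f1 f2].
    by split; [by []|lra|rewrite addn0 !big_geq// addn0].
  have [|f [f1 f2 gf]] := IH; first by apply: leq_trans dm; rewrite leq_add2l.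
  have aS : a d = a d.+1 + theta.
    by rewrite /a addnS -[in RHS]natr1; lra.
  have gH' j : a d.+1 <= j%:R <= a d.+1 + d.+1%:R -> (g (i + d.+1)%N <= H j)%E.
    move=> jd; apply: gH; first by rewrite dm andbT addnS ltnS leq_addr.
    by rewrite -/(a d.+1) natrD [i%:R + _]addrC addrK.
  have dS : d.+1%:R = d%:R + 1 :> R by rewrite natr1.
  have d0 : 0 <= d%:R :> R by rewrite ler0n.
  (* Either [f] is still the ceiling of the new left end and [f + d] is gained on the right, or the
     ceiling drops to [f - 1], which is gained on the left. *)
  have [fa|fa] := ltP f%:R (a d.+1 + 1).
    exists f; split; [by lra|by []|].
    rewrite addnS big_nat_recr/=; last by rewrite ltnS leq_addr.
    rewrite [(f + d.+1)%N]addnS [X in (_ <= X)%E]big_nat_recr/= ?leq_addr//.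
    by apply: leeD => //; rewrite -addnS; apply: gH'; rewrite natrD; lra.
  have a0 : 0 <= a d.+1.
    by rewrite addr_ge0// mulr_ge0// ?ler0n// subr_ge0 ler_nat.
  case: f => [|f] in f1 f2 gf fa *; first by lra.
  have fS : f.+1%:R = f%:R + 1 :> R by rewrite natr1.
  exists f; split; [by lra|by lra|].
  rewrite addnS big_nat_recr/=; last by rewrite ltnS leq_addr.
  rewrite [(f + d.+1)%N]addnS [X in (_ <= X)%E]big_ltn ?ltnS ?leq_addr// addeC.
  by apply: leeD; [rewrite -addnS; apply: gH'; lra|rewrite -addSn].
have [|f [_ fm]] := win (m - i)%N; first by rewrite subnKC.
rewrite subnKC// => /le_trans; apply.
(* The last window starts at the ceiling of [i lam], hence at most at [i], so its [m - i] integers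
   lie in [[0, m]]. *)
have fi : (f <= i)%N.
  rewrite -ltnS -(ltr_nat R) -natr1; apply: lt_le_trans fm _.
  by rewrite /a subnKC// subrr mul0r add0r lerD2r ler_piMr.
rewrite [X in (_ <= X)%E](big_cat_nat (n := f))//=; last by lia.
rewrite (big_cat_nat (n := (f + (m - i))%N) (m := f) (p := m.+1))//=; try lia.
by rewrite addeCA leeDl// adde_ge0// sume_ge0.
Qed.

(** Only the least index [k] with [E k] matters: earlier terms vanish and the tail from [k] on is
    bounded by hypothesis. Applied with [E i] saying that [x] lies near the [i]-th dilate of the
    join, this replaces integration over the gauge. *)
Lemma abel_nested_le (R : realType) (E : nat -> bool) (c : nat -> \bar R)
    (B : \bar R) (m : nat) :
  (0 <= B)%E -> (forall i, 0 <= c i)%E ->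
  (forall i, (i < m)%N -> E i -> \sum_(i <= k < m) c k <= B)%E ->
  (\sum_(0 <= i < m) ((E i)%:R%:E * c i) <= B)%E.
Proof.
move=> B0 c0 cB.
have c_le a b : (\sum_(a <= i < b) ((E i)%:R%:E * c i) <= \sum_(a <= i < b) c i)%E.
  by apply: lee_sum => i _; case: (E i); rewrite ?mul1e// mul0e.
have [[i /andP[im Ei]]|noE] := pselect (exists i, (i < m)%N && E i); last first.
  rewrite big_nat big1// => i im; case: (boolP (E i)) => [Ei|]; last by rewrite mul0e.
  by exfalso; apply: noE; exists i; move: im => /= ->.
have ex : exists i, (i < m)%N && E i by exists i; rewrite im.
case: (ex_minnP ex) => k /andP[km Ek] kmin.
rewrite (big_cat_nat (n := k))//=; last exact: ltnW.
rewrite [X in (X + _)%E]big_nat [X in (X + _)%E]big1 ?add0e.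
  exact: le_trans (c_le _ _) (cB _ km Ek).
move=> j jk; case: (boolP (E j)) => [Ej|]; last by rewrite mul0e.
have := kmin j; rewrite Ej (ltn_trans jk km) leqNgt => /(_ isT).
by move: jk => /= ->.
Qed.

(** * Convex combinations and the join *)

(** By convexity the point is [al + be] times a point of [K], and [0] in [K] absorbs the slack
    [t - (al + be)]. *)
Lemma convex_combination_dil (R : realType) (n : nat) (K : set 'rV[R]_n)
    (al be t : R) (x y : 'rV[R]_n) : Defs.convex_set K -> K 0 ->
  0 <= al -> 0 <= be -> al + be <= t -> K x -> K y ->
  dil t K (al *: x + be *: y).
Proof.
move=> cK K0 al0 be0 abt Kx Ky.
have [ab0|abN0] := eqVneq (al + be) 0.
  have -> : al = 0 by lra.
  have -> : be = 0 by lra.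
  by exists 0 => //; rewrite !scale0r addr0 scaler0.
have ab_gt0 : 0 < al + be by rewrite lt_neqAle eq_sym abN0 addr_ge0.
have t0 : 0 < t by lra.
pose z := (al / (al + be)) *: x + (1 - al / (al + be)) *: y.
have Kz : K z.
  apply: (cK _ _ _ Kx Ky); rewrite divr_ge0 ?(ltW ab_gt0)//=.
  by rewrite ler_pdivrMr// mul1r lerDl.
exists (((al + be) / t) *: z + (1 - (al + be) / t) *: 0).
  apply: (cK _ _ _ Kz K0); rewrite divr_ge0 ?(ltW ab_gt0) ?(ltW t0)//=.
  by rewrite ler_pdivrMr// mul1r.
have tN0 : t != 0 by rewrite gt_eqF.
rewrite scaler0 addr0 scalerA mulrC divfK// scalerDr !scalerA.
by congr (_ *: _ + _ *: _); field.
Qed.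

(** The union of the segments from [L] to [- K], which gives points of the join explicit
    coordinates. *)
Definition segment_hull (R : realType) (n : nat) (K L : set 'rV[R]_n) :
    set 'rV[R]_n :=
  [set x | exists lam k l, [/\ 0 <= lam <= 1, K k, L l &
    x = (1 - lam) *: l - lam *: k]].

(** The union of segments contains [L] and [- K] and is convex: in a combination of two of its
    points, the [K] parts and the [L] parts are regrouped separately. *)
Lemma cvx_join_refl_sub (R : realType) (n : nat) (K L : set 'rV[R]_n) :
  Defs.convex_set K -> Defs.convex_set L -> K 0 -> L 0 ->
  cvx_join L (refl K) `<=` segment_hull K L.
Proof.
move=> cK cL K0 L0 x; apply.
  move=> _ _ t [a [k [l [/andP[a0 a1] Kk Ll ->]]]] [b [k' [l' [/andP[b0 b1] Kk' Ll' ->]]]].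
  move=> /andP[t0 t1].
  have ta0 : 0 <= t * a by rewrite mulr_ge0.
  have tb0 : 0 <= (1 - t) * b by rewrite mulr_ge0//; lra.
  have ta1 : 0 <= t * (1 - a) by rewrite mulr_ge0//; lra.
  have tb1 : 0 <= (1 - t) * (1 - b) by rewrite mulr_ge0//; lra.
  (* Working with dilates avoids dividing by a total weight that may be 0. *)
  have [k2 Kk2 k2E] := convex_combination_dil cK K0 ta0 tb0 (lexx _) Kk Kk'.
  have [l2 Ll2 l2E] := convex_combination_dil cL L0 ta1 tb1 (lexx _) Ll Ll'.
  exists (t * a + (1 - t) * b), k2, l2; split=> //.
    by apply/andP; split; rewrite ?addr_ge0//; lra.
  rewrite k2E (_ : 1 - (t * a + (1 - t) * b) =
    t * (1 - a) + (1 - t) * (1 - b)); last by ring.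
  rewrite l2E !scalerBr !scalerA !opprD.
  by rewrite !addrA; congr (_ - _); rewrite addrAC.
move=> y [Ly|[k Kk <-]].
  by exists 0, 0, y; split; rewrite ?lexx ?ler01// subr0 scale1r scale0r subr0.
by exists 1, k, 0; split; rewrite ?lexx ?ler01// scaler0 scale1r sub0r.
Qed.

Lemma le_Vol (R : realType) (n : nat) (A B : set 'rV[R]_n) :
  A `<=` B -> (Vol A <= Vol B)%E.
Proof.
move=> AB; apply: ereal_inf_le_tmp => _ [a [b [Bab ->]]].
by exists a, b; split=> //; exact: subset_trans Bab.
Qed.

(** * Fibre counts and their sum over the lattice *)

(* A point [t = j / m] of the window is [(1 - r) theta + s lam + (r - s) tau] with
   [r = k / m], [s = i / m] and [0 <= tau <= 1]; for [x = s ((1 - lam) l - lam y)]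
   and [u] in [theta K `&` (1 - theta) L], the point [(1 - r) u + s lam y] lies in
   [t K] and becomes a point of [(1 - t) L] after adding [x]. *)
Lemma lattice_fibre_ge (R : realType) (n m i : nat) (K L : set 'rV[R]_n)
    (theta h : R) (x : 'rV[int]_n) :
  (0 < n)%N -> 0 < h -> Defs.convex_set K -> Defs.convex_set L ->
  K 0 -> L 0 -> 0 <= theta <= 1 -> (i < m)%N ->
  lattice_near h h [set (0 + (i%:R / m%:R) *: p)%R | p in segment_hull K L] x ->
  (\sum_(i <= k < m) ((((m%:R - k.+1%:R) / m%:R) ^+ n)%:E *
      Vol (dil theta K `&` dil (1 - theta) L)) <=
   \sum_(0 <= j < m.+1) ((h ^+ n)%:E * card_set R
     [set w | lattice_near h (2 * h) (dil (j%:R / m%:R) K) w /\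
        lattice_near h (2 * h) (dil (1 - j%:R / m%:R) L) (w + x)%R]))%E.
Proof.
move=> n0 h0 cK cL K0 L0 th01 im [_ [p [lam [y [l [lam01 Ky Ll pE]]]] <-] xp].
have mR0 : 0 < m%:R :> R by rewrite ltr0n (leq_ltn_trans _ im).
have /andP[la0 la1] := lam01; have /andP[th0 th1] := th01.
pose g k : \bar R := ((((m%:R - k%:R) / m%:R) ^+ n)%:E *
  Vol (dil theta K `&` dil (1 - theta) L))%E.
rewrite -(big_add1 _ _ i m.+1 xpredT g).
apply: (nested_window_sum th01 lam01 (ltnW im)) => [j|k j /andP[ik km] /andP[]].
  by rewrite mule_ge0 ?card_set_ge0// lee_fin exprn_ge0// ltW.
set a := _ + i%:R * lam => aj ja.
pose s : R := i%:R / m%:R; pose r : R := k%:R / m%:R; pose t : R := j%:R / m%:R.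
have rE : (m%:R - k%:R) / m%:R = 1 - r by rewrite mulrBl divff// gt_eqF.
have aE : a / m%:R = (1 - r) * theta + s * lam.
  by rewrite /a mulrDl -rE /s; congr (_ + _); rewrite mulrAC.
have at1 : (1 - r) * theta + s * lam <= t by rewrite -aE ler_pM2r ?invr_gt0.
have at2 : t <= (1 - r) * theta + s * lam + (r - s).
  by rewrite -aE -mulrBl -mulrDl ler_pM2r ?invr_gt0.
have s0 : 0 <= s by rewrite divr_ge0 ?ler0n.
have r1 : 0 <= 1 - r by rewrite -rE divr_ge0 ?ler0n// subr_ge0 ler_nat.
have la1' : 0 <= 1 - lam by lra.
have rth0 : 0 <= (1 - r) * theta by rewrite mulr_ge0.
have rth1 : 0 <= (1 - r) * (1 - theta) by rewrite mulr_ge0// subr_ge0.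
have sl0 : 0 <= s * lam by rewrite mulr_ge0.
have sl1 : 0 <= s * (1 - lam) by rewrite mulr_ge0// subr_ge0.
rewrite /g rE.
apply: le_trans (Vol_lattice_le _ ((s * lam) *: y) n0 r1 h0) _.
apply: lee_wpmul2l; first by rewrite lee_fin exprn_ge0// ltW.
apply: le_card_set => w [_ [u [[u1 Ku1 u1E] [u2 Lu2 u2E]] <-] wu].
have h2 : h <= 2 * h by lra.
have abt : (1 - r) * (1 - theta) + s * (1 - lam) <= 1 - t by lra.
split.
  exists ((s * lam) *: y + (1 - r) *: u); last by move=> c; exact: le_trans h2.
  rewrite addrC -u1E scalerA.
  exact: convex_combination_dil.
exists ((s * lam) *: y + (1 - r) *: u + s *: p).
  rewrite pE -u2E scalerBr !scalerA.
  rewrite (_ : _ + _ + _ = ((1 - r) * (1 - theta)) *: u2 + (s * (1 - lam)) *: l).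
    exact: convex_combination_dil.
  by rewrite addrC addrA subrK addrC.
move=> c; have := xp c; have := wu c; rewrite !mxE add0r -/s intrD !ler_norml.
move=> /andP[? ?] /andP[? ?]; by apply/andP; split; lra.
Qed.

(** A discrete Fubini argument: sum the fibre bound over all lattice vectors [x]. On the left, the
    points near the [i]-th dilate of the hull are counted and bound its volume; on the right,
    [card_set_conv] turns the fibre counts into a product of two counts. *)
Lemma lattice_product_ge (R : realType) (n m : nat) (K L : set 'rV[R]_n)
    (theta h mu : R) (al be : nat -> R) :
  (0 < n)%N -> 0 < h -> Defs.convex_set K -> Defs.convex_set L ->
  K 0 -> L 0 -> 0 <= theta <= 1 ->
  Vol (dil theta K `&` dil (1 - theta) L) = mu%:E ->
  (forall j, (j <= m)%N -> (h ^+ n)%:E * card_set R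
     (lattice_near h (2 * h) (dil (j%:R / m%:R) K)) <= (al j)%:E)%E ->
  (forall j, (j <= m)%N -> (h ^+ n)%:E * card_set R
     (lattice_near h (2 * h) (dil (1 - j%:R / m%:R) L)) <= (be j)%:E)%E ->
  (\sum_(0 <= i < m) ((((m%:R - i.+1%:R) / m%:R) ^+ n * mu)%:E *
      (((i%:R / m%:R) ^+ n)%:E * Vol (segment_hull K L))) <=
   (\sum_(0 <= j < m.+1) al j * be j)%R%:E)%E.
Proof.
move=> n0 h0 cK cL K0 L0 th01 Mmu.
set A := fun j => lattice_near h (2 * h) (dil (j%:R / m%:R) K).
set B := fun j => lattice_near h (2 * h) (dil (1 - j%:R / m%:R) L).
move=> Aal Bbe.
pose E i := lattice_near h h
  [set (0 + (i%:R / m%:R) *: p)%R | p in segment_hull K L].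
have hn0 : 0 < h ^+ n by rewrite exprn_gt0.
have hn0E : (0 <= (h ^+ n)%:E)%E by rewrite lee_fin ltW.
have mu0 : 0 <= mu by rewrite -lee_fin -Mmu Vol_ge0.
(* [card_set_conv] needs a real count; the bounds [al] and [be] provide it since [h ^+ n] is
   positive. *)
have card_fin S c : ((h ^+ n)%:E * card_set R S <= c%:E)%E ->
    exists2 b, card_set R S = b%:E & 0 <= h ^+ n * b <= c.
  move=> Sc; have := card_set_ge0 R S; move: Sc.
  case: (card_set R S) => [b||]//.
    rewrite -EFinM !lee_fin => bc b0; exists b => //.
    by rewrite mulr_ge0// ltW.
  by rewrite gt0_muley ?lte_fin// leNgt ltry.
pose f x j := ((h ^+ n)%:E * card_set R [set w | A j w /\ B j (w + x)%R])%E.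
have f0 x j : (0 <= f x j)%E by rewrite mule_ge0 ?card_set_ge0.
(* From [m] on, [m - i.+1] is negative; the value 0 keeps all weights nonnegative. *)
pose c i : R := if (i < m)%N then ((m%:R - i.+1%:R) / m%:R) ^+ n * mu else 0.
have c0 i : 0 <= c i.
  rewrite /c; case: ifPn => // im; rewrite mulr_ge0// exprn_ge0//.
  by rewrite divr_ge0 ?ler0n// subr_ge0 ler_nat.
have cE i : (0 <= (c i)%:E)%E by rewrite lee_fin.
have fibre x : (\sum_(0 <= i < m) ((x \in E i)%:R%:E * (c i)%:E) <=
    \sum_(0 <= j < m.+1) f x j)%E.
  apply: abel_nested_le => //; first by apply: sume_ge0.
  move=> i im /set_mem Eix.
  apply: le_trans (lattice_fibre_ge n0 h0 cK cL K0 L0 th01 im Eix).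
  by rewrite !big_nat; apply: lee_sum => k /andP[_ km]; rewrite /c km Mmu -EFinM.
have total : (\esum_(x in setT) \sum_(0 <= i < m) ((x \in E i)%:R%:E * (c i)%:E) <=
    \esum_(x in setT) \sum_(0 <= j < m.+1) f x j)%E.
  by apply: le_esum => x _; exact: fibre.
rewrite !esum_sum// in total; last by move=> *; rewrite mule_ge0// lee_fin.
(* [f] already carries one factor [h ^+ n]; the second one normalises the other count. *)
have {total} := lee_wpmul2l hn0E total.
rewrite !ge0_sume_distrr; last 2 first.
- by move=> *; exact: esum_ge0.
- by move=> *; apply: esum_ge0 => *; rewrite mule_ge0// lee_fin.
move=> total; apply: le_trans (le_trans _ total) _.
  rewrite !big_nat; apply: lee_sum => i /andP[_ im].
  under eq_esum do rewrite muleC.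
  rewrite esumZl//.
  rewrite -card_set_mkcond [leRHS]muleCA {1}/c im; apply: lee_wpmul2l.
    by have := cE i; rewrite /c im.
  by apply: Vol_lattice_le => //; exact: divr_ge0.
rewrite -sumEFin !big_nat; apply: lee_sum => j /andP[_ jm].
have [a aE /andP[a0 al_j]] := card_fin _ _ _ (Aal j jm).
have [b bE /andP[b0 be_j]] := card_fin _ _ _ (Bbe j jm).
rewrite /f esumZl//; last by move=> x; exact: card_set_ge0.
rewrite (card_set_conv _ bE) aE -!EFinM lee_fin.
have -> : h ^+ n * (h ^+ n * (a * b)) = (h ^+ n * a) * (h ^+ n * b) by ring.
exact: ler_pM.
Qed.

(** * Growth of the beta sums *)

(* [m ^ (2 n + 1)] times a Riemann sum for the integral of [t ^ n (1 - t) ^ n]. *)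
Definition beta_sum (n m : nat) : nat := (\sum_(0 <= j < m.+1) j ^ n * (m - j) ^ n)%N.

Lemma bernoulli_ineq (R : realType) (q : R) (l : nat) :
  1 <= q -> 1 + l%:R * (q - 1) <= q ^+ l.
Proof.
move=> q1; elim: l => [|l IH]; first by rewrite mul0r addr0.
have q0 : 0 <= q by lra.
rewrite exprS; apply: le_trans (ler_wpM2l q0 IH).
have : 0 <= l%:R * (q - 1) ^+ 2 by rewrite mulr_ge0 ?ler0n// sqr_ge0.
by rewrite -natr1; nra.
Qed.

(** Take [k = l (d + 1)]. Bernoulli gives [q ^ k >= (l (q - 1)) ^ (d + 1)], while
    [k + 3 <= (d + 4) l]; the choice of [l] above [b] makes the extra factor [l] win. *)
Lemma exists_poly_lt_expr (R : realType) (q : R) (d : nat) :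
  1 < q -> exists k : nat, ((k.+3 ^ d)%N)%:R < q ^+ k.
Proof.
move=> q1; have e0 : 0 < q - 1 by rewrite subr_gt0.
pose b : R := (d.+4%:R ^+ d) / (q - 1) ^+ d.+1.
pose l := (Num.truncn b).+1.
have bl : b < l%:R by exact: truncnS_gt.
have l0 : 0 < l%:R :> R by rewrite ltr0n.
exists (l * d.+1)%N.
apply: (@le_lt_trans _ _ ((d.+4%:R * l%:R) ^+ d)).
  rewrite natrX; apply: lerXn2r; rewrite ?nnegrE ?ler0n ?mulr_ge0//.
  by rewrite -natrM ler_nat; rewrite /l; nia.
apply: (@lt_le_trans _ _ ((l%:R * (q - 1)) ^+ d.+1)).
  move: bl; rewrite ltr_pdivrMr ?exprn_gt0// => bl.
  by rewrite !exprMn [l%:R ^+ d.+1]exprSr -mulrA mulrC ltr_pM2l// exprn_gt0.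
rewrite exprM; apply: lerXn2r; rewrite ?nnegrE ?exprn_ge0 ?mulr_ge0//; try lra.
by apply: le_trans (bernoulli_ineq _ (ltW q1)); rewrite lerDr.
Qed.

Lemma beta_sum_le (n m : nat) : (beta_sum n m <= m.+1 ^ (n + n).+1)%N.
Proof.
have pow_le a : (a <= m.+1)%N -> (a ^ n <= m.+1 ^ n)%N.
  by case: n => // n; rewrite leq_exp2r.
rewrite /beta_sum big_mkord expnS -[X in (_ <= X * _)%N]card_ord -sum_nat_const.
apply: leq_sum => j _; rewrite expnD leq_mul// pow_le//.
  exact: ltnW (ltn_ord j).
exact: leq_trans (leq_subr _ _) (leqnSn _).
Qed.

(** The term [j = 1] equals 1. For [n > 0] the sums at 0 and 1 vanish, so the growth argument starts
    at 2. *)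
Lemma beta_sum2_gt0 (n : nat) : (0 < beta_sum n 2)%N.
Proof.
by rewrite /beta_sum !big_nat_recr//= addn_gt0 addn_gt0 muln_gt0 !expn_gt0 orbT.
Qed.

(** If [0 < c < v], the sums grow at least like powers of [v / c > 1] from index 2 on, against the
    polynomial bound [beta_sum_le]. *)
Lemma beta_sum_ratio_le (R : realType) (n : nat) (v c : R) : 0 <= c ->
  (forall m, v * (beta_sum n m)%:R <= c * (beta_sum n m.+1)%:R) -> v <= c.
Proof.
move=> c0 vc; rewrite leNgt; apply/negP => cv.
have S2R : 1 <= (beta_sum n 2)%:R :> R by rewrite ler1n beta_sum2_gt0.
have [c_eq0|cN0] := eqVneq c 0.
  have := vc 2%N; rewrite c_eq0 mul0r leNgt => /negP; apply.
  by rewrite mulr_gt0//; lra.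
have c_gt0 : 0 < c by rewrite lt_neqAle eq_sym cN0.
have q1 : 1 < v / c by rewrite ltr_pdivlMr// mul1r.
have grow k : (v / c) ^+ k <= (beta_sum n k.+2)%:R.
  elim: k => [|k IH]; first by rewrite expr0.
  have q0 : 0 <= v / c by lra.
  rewrite exprS; apply: le_trans (ler_wpM2l q0 IH) _.
  by rewrite mulrAC ler_pdivrMr// [leRHS]mulrC.
have [k] := exists_poly_lt_expr (n + n).+1 q1.
rewrite ltNge => /negP; apply; apply: le_trans (grow k) _.
by rewrite ler_nat beta_sum_le.
Qed.

(** * Passage to volumes and conclusion *)

Lemma Vol_riemann_sum_le (R : realType) (n m : nat) (K L : set 'rV[R]_n)
    (theta kap ell mu : R) :
  (0 < n)%N -> compact K -> compact L -> Defs.convex_set K -> Defs.convex_set L ->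
  K 0 -> L 0 -> 0 <= theta <= 1 -> Vol K = kap%:E -> Vol L = ell%:E ->
  Vol (dil theta K `&` dil (1 - theta) L) = mu%:E ->
  (\sum_(0 <= i < m.+1) ((((m.+1%:R - i.+1%:R) / m.+1%:R) ^+ n * mu)%:E *
      (((i%:R / m.+1%:R) ^+ n)%:E * Vol (segment_hull K L))) <=
   (\sum_(0 <= j < m.+2) (j%:R / m.+1%:R) ^+ n * kap *
      ((1 - j%:R / m.+1%:R) ^+ n * ell))%R%:E)%E.
Proof.
move=> n0 kK kL cK cL K0 L0 th01 VK VL VM.
have kap0 : 0 <= kap by rewrite -lee_fin -VK Vol_ge0.
have ell0 : 0 <= ell by rewrite -lee_fin -VL Vol_ge0.
apply/lee_addgt0Pr => eps eps0.
(* For [eta <= 1], adding [eta] to both factors raises each product by at most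
   [eta * (kap + ell + 1)], and [j] takes [m + 2] values. *)
pose D : R := m.+2%:R * (kap + ell + 1).
have D0 : 0 < D by rewrite mulr_gt0// ltr_wpDl// addr_ge0.
pose eta : R := Num.min 1 (eps / D).
have eta0 : 0 < eta by rewrite lt_min ltr01 divr_gt0.
have eta1 : eta <= 1 by rewrite ge_min lexx.
have etaD : eta * D <= eps by rewrite -ler_pdivlMr// ge_min lexx orbT.
have [hK hK0 hKP] := lattice_compact_le kK VK eta0.
have [hL hL0 hLP] := lattice_compact_le kL VL eta0.
pose h := Num.min hK hL.
have h0 : 0 < h by rewrite lt_min hK0.
have hhK : 0 < h <= hK by rewrite h0 ge_min lexx.
have hhL : 0 < h <= hL by rewrite h0 ge_min lexx orbT.
have j01 j : (j <= m.+1)%N -> 0 <= (j%:R / m.+1%:R : R) <= 1.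
  move=> jm; rewrite divr_ge0 ?ler0n//= ler_pdivrMr ?ltr0n// mul1r.
  by rewrite ler_nat.
have j01' j : (j <= m.+1)%N -> 0 <= (1 - j%:R / m.+1%:R : R) <= 1.
  by move=> /j01 /andP[? ?]; rewrite subr_ge0 lerBlDr lerDl; apply/andP.
apply: le_trans (lattice_product_ge n0 h0 cK cL K0 L0 th01 VM
  (fun j jm => hKP h _ hhK (j01 j jm)) (fun j jm => hLP h _ hhL (j01' j jm))) _.
rewrite -EFinD lee_fin -lerBlDl -sumrB; apply: le_trans etaD.
have -> : eta * D = \sum_(0 <= j < m.+2) eta * (kap + ell + 1).
  by rewrite sumr_const_nat subn0 /D mulrCA mulr_natl.
rewrite !big_nat; apply: ler_sum => j /andP[_ jm].
have /andP[t0 t1] := j01 j jm; have /andP[s0 s1] := j01' j jm.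
move: (exprn_ile1 n t0 t1) (exprn_ge0 n t0) (exprn_ile1 n s0 s1) (exprn_ge0 n s0).
set a := _ ^+ n; set b := (1 - _) ^+ n => a1 a0 b1 b0.
have ak : a * kap <= kap by rewrite ler_piMl.
have bl : b * ell <= ell by rewrite ler_piMl.
have : 0 <= eta * ((kap - a * kap) + (ell - b * ell) + (1 - eta)).
  by rewrite mulr_ge0 ?(ltW eta0)//; lra.
by lra.
Qed.

Lemma beta_sum_scaled (R : realType) (n m : nat) :
  \sum_(0 <= j < m.+2) (j%:R / m.+1%:R) ^+ n * (1 - j%:R / m.+1%:R) ^+ n =
  (beta_sum n m.+1)%:R / m.+1%:R ^+ (n + n) :> R.
Proof.
rewrite /beta_sum natr_sum mulr_suml !big_nat; apply: eq_bigr => j /andP[_ jm].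
rewrite natrM !natrX natrB// !exprMn exprD.
rewrite (_ : 1 - j%:R / m.+1%:R = (m.+1%:R - j%:R) / m.+1%:R).
  by rewrite !exprMn invfM mulrACA !exprVn.
by rewrite mulrBl divff.
Qed.

(** The weight at [i.+1] meets the level at [i], and [m.+1 - i.+1 = m - i]; this shift is why the
    sum has index [m] although the step is [1 / m.+1]. *)
Lemma beta_sum_scaled_pred (R : realType) (n m : nat) :
  \sum_(0 <= i < m.+1) ((m.+1%:R - i.+1%:R) / m.+1%:R) ^+ n * (i%:R / m.+1%:R) ^+ n =
  (beta_sum n m)%:R / m.+1%:R ^+ (n + n) :> R.
Proof.
rewrite /beta_sum natr_sum mulr_suml !big_nat; apply: eq_bigr => i /andP[_ im].
rewrite natrM !natrX !exprMn exprD -natrB// subSS invfM.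
by rewrite mulrACA [in LHS]mulrC !exprVn mulrC [X in X * _]mulrC.
Qed.

Lemma beta_sum_Vol_le (R : realType) (n m : nat) (K L : set 'rV[R]_n)
    (theta kap ell mu : R) :
  (0 < n)%N -> compact K -> compact L -> Defs.convex_set K -> Defs.convex_set L ->
  K 0 -> L 0 -> 0 <= theta <= 1 -> Vol K = kap%:E -> Vol L = ell%:E ->
  Vol (dil theta K `&` dil (1 - theta) L) = mu%:E ->
  ((mu * (beta_sum n m)%:R)%:E * Vol (segment_hull K L) <=
   (kap * ell * (beta_sum n m.+1)%:R)%:E)%E.
Proof.
move=> n0 kK kL cK cL K0 L0 th01 VK VL VM.
have mu0 : 0 <= mu by rewrite -lee_fin -VM Vol_ge0.
have := Vol_riemann_sum_le m n0 kK kL cK cL K0 L0 th01 VK VL VM.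
set V := Vol (segment_hull K L); have V0 : (0 <= V)%E := Vol_ge0 _.
pose p : R := m.+1%:R ^+ (n + n).
have p0 : 0 < p by rewrite exprn_gt0 ?ltr0n.
under eq_big_nat => i /andP[_ im] do rewrite muleA -EFinM mulrAC.
rewrite big_nat -ge0_sume_distrl => [|i /andP[_ im]]; last first.
  by rewrite lee_fin !mulr_ge0// exprn_ge0// divr_ge0// ?subr_ge0 ?ler_nat ?ler0n.
rewrite -big_nat sumEFin -mulr_suml beta_sum_scaled_pred -/p.
under eq_bigr => j _ do rewrite mulrACA.
rewrite -mulr_suml beta_sum_scaled -/p => le_V.
have pE : (0 <= p%:E)%E by rewrite lee_fin ltW.
have := lee_wpmul2l pE le_V; rewrite muleA -!EFinM.
have -> : p * ((beta_sum n m)%:R / p * mu) = mu * (beta_sum n m)%:R.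
  by field; rewrite gt_eqF.
have -> // : p * ((beta_sum n m.+1)%:R / p * (kap * ell)) =
  kap * ell * (beta_sum n m.+1)%:R.
by field; rewrite gt_eqF.
Qed.

Theorem theorem1p6 (R : realType) (n : nat) (K L : set 'rV[R]_n)
  (hK : convex_body K) (hL : convex_body L) (h0 : (K `&` L) 0)
  (theta : R) (ht : 0 <= theta <= 1) :
  (Vol (cvx_join L (refl K)) * Vol (dil theta K `&` dil (1 - theta) L)
     <= Vol K * Vol L)%E.
Proof.
move: hK hL h0 => [kK [cK _]] [kL [cL _]] [K0 L0].
have [n0|n_gt0] := posnP n.
  (* In dimension 0 every box has volume 1, an empty product, so every cover has infinite total and
     the right-hand side is [+oo]. *)
  have VolT (A : set 'rV[R]_n) : Vol A = +oo%E.
    apply/ereal_inf_pinfty => _ [a [b [_ ->]]]; apply/eq_infty => r.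
    apply: le_trans (nneseries_lim_ge (Num.truncn r).+1 _); last first.
      by move=> k _ _; rewrite lee_fin box_vol_ge0.
    under eq_bigr => k _.
      rewrite /box_vol big1; last by move=> i; have := ltn_ord i; rewrite {2}n0.
      over.
    by rewrite sumEFin lee_fin sumr_const_nat subn0 ltW// truncnS_gt.
  by rewrite !VolT leey.
(* As [0] lies in [K], [theta K] is contained in [K]; this makes the volume of the intersection
   finite. *)
have MK : dil theta K `&` dil (1 - theta) L `<=` K.
  move=> _ [[x Kx <-] _]; have := cK _ _ _ Kx K0 ht.
  by rewrite scaler0 addr0.
have /fineK /esym VK := compact_Vol_fin_num n_gt0 kK.
have /fineK /esym VL := compact_Vol_fin_num n_gt0 kL.
have VM_fin : Vol (dil theta K `&` dil (1 - theta) L) \is a fin_num.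
  by rewrite ge0_fin_numE ?Vol_ge0// (le_lt_trans (le_Vol MK))// VK ltry.
have /fineK /esym VM := VM_fin.
set kap := fine _ in VK; set ell := fine _ in VL; set mu := fine _ in VM.
have kap0 : 0 <= kap by rewrite -lee_fin -VK Vol_ge0.
have ell0 : 0 <= ell by rewrite -lee_fin -VL Vol_ge0.
have mu0 : 0 <= mu by rewrite -lee_fin -VM Vol_ge0.
have beta_le m := beta_sum_Vol_le m n_gt0 kK kL cK cL K0 L0 ht VK VL VM.
rewrite VM VK VL.
apply: (@le_trans _ _ (Vol (segment_hull K L) * mu%:E)%E).
  apply: lee_wpmul2r; first by rewrite lee_fin.
  exact: le_Vol (cvx_join_refl_sub cK cL K0 L0).
have [->|muN0] := eqVneq mu 0; first by rewrite mule0 mule_ge0 ?lee_fin.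
have mu_gt0 : 0 < mu by rewrite lt_neqAle eq_sym muN0.
move: beta_le (Vol_ge0 (segment_hull K L)).
case: (Vol (segment_hull K L)) => [q||]// beta_le q0.
  rewrite -!EFinM lee_fin mulrC; apply: (@beta_sum_ratio_le _ n).
    by rewrite mulr_ge0.
  by move=> m; have := beta_le m; rewrite -EFinM lee_fin mulrAC.
(* If the hull had infinite volume, the left side at [m = 2] would be [+oo], because [mu] and
   [beta_sum n 2] are positive, while the right side is real. *)
have := beta_le 2%N; rewrite gt0_muley ?lte_fin ?mulr_gt0 ?ltr0n ?beta_sum2_gt0//.
Qed.
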